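(* Let $J=\{1,\dots,n\}$, let $x_j\in\mathbb{R}^m$, $y_j\in\mathbb{R}^s$ ($j\in J$) be vectors with strictly positive components, and let $DMU_o=(x_o,y_o)$, $o\in J$, be $FDH_V$-efficient. Let $\sigma_o^+$ and $\sigma_o^-$ be its maximum incremental and minimum decremental ratios. Then: (i) Right-IRS prevails at $DMU_o$ if and only if $\sigma_o^+>1$. (ii) Right-DRS prevails at $DMU_o$ if and only if $\sigma_o^+<1$. (iii) Right-CRS prevails at $DMU_o$ if and only if $\sigma_o^+=1$. (iv) Left-IRS prevails at $DMU_o$ if and only if $\sigma_o^->1$. (v) Left-DRS prevails at $DMU_o$ if and only if $\sigma_o^-<1$. (vi) Left-CRS prevails at $DMU_o$ if and only if $\sigma_o^-=1$.
   Context: There are $n$ decision making units $DMU_j=(x_j,y_j)$, $j\in J$, with strictly positive input vectors $x_j\in\mathbb{R}^m$ and output vectors $y_j\in\mathbb{R}^s$. Vector inequalities are componentwise. The technology is $$T^{FDH_V}=\Big\{(x,y)\in\mathbb{R}^m\times\mathbb{R}^s:\ \exists\,\lambda\in\{0,1\}^n,\ \sum_{j}\lambda_j=1,\ \sum_j\lambda_jx_j\le x,\ \sum_j\lambda_jy_j\ge y\ge0\Big\}.$$ $DMU_o$ is $FDH_V$-efficient if there is no $(x,y)\in T^{FDH_V}$ with $x\le x_o$, $y\ge y_o$, $(x,y)\neq(x_o,y_o)$. Response function: $\beta_o(\alpha):=\max\{\beta\in\mathbb{R}:\ (\alpha x_o,\beta y_o)\in T^{FDH_V}\}$, defined for those $\alpha$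 for which some such $\beta$ exists. Its domain is $[\underline{\alpha},+\infty)$ for some $\underline{\alpha}\le1$. Maximum incremental ratio and minimum decremental ratio: $$\sigma_o^+:=\max_{\alpha>1}\frac{\beta_o(\alpha)-1}{\alpha-1},\qquad \sigma_o^-:=\min_{\underline{\alpha}\le\alpha<1}\frac{\beta_o(\alpha)-1}{\alpha-1},$$ with the convention $\sigma_o^-=+\infty$ if $\underline{\alpha}=1$ (minimum over the empty set). $\operatorname{int}A$ and $A^c$ denote the interior and the complement of a set $A$ (in $\mathbb{R}^{m+s}$), and $z_\delta:=(\delta x_o,\delta y_o)$. One-sided returns to scale for an $FDH_V$-efficient $DMU_o$: Right-IRS prevails if $z_\delta\in\operatorname{int}T^{FDH_V}$ for some $\delta>1$; Right-DRS prevails if $z_\delta\in(T^{FDH_V})^c$ for each $\delta>1$; Right-CRS prevails if neither Right-IRS nor Right-DRS prevails. Left-IRS prevails if $z_\delta\in(T^{FDH_V})^c$ for each $0<\delta<1$; Left-DRS prevails if $z_\delta\in\operatorname{int}T^{FDH_V}$ for some $0<\delta<1$; Left-CRS prevails if neither Left-IRS nor Left-DRS prevails. *)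

(* Defs.v *)
From HB Require Import structures.
From mathcomp Require Import all_boot all_order all_algebra.
From mathcomp Require Import all_classical all_reals all_analysis.
Set Implicit Arguments.
Unset Strict Implicit.
Unset Printing Implicit Defensive.
Import Order.TTheory GRing.Theory Num.Theory.
Import numFieldNormedType.Exports.
Local Open Scope classical_set_scope.
Local Open Scope ring_scope.

Section Extrema.
Context {R : realType}.
Implicit Types A : set R.

(* The greatest (resp. least) element of A, attained in A; when A has none,
   the value is the arbitrary default 0. *)
Definition set_max A : R := xget 0 (A `&` ubound A).
Definition set_min A : R := xget 0 (A `&` lbound A).

End Extrema.

Definition vle {R : realType} {k : nat} (u v : 'rV[R]_k) : Prop :=
  forall i, u 0 i <= v 0 i.

Definition vpos {R : realType} {k : nat} (u : 'rV[R]_k) : Prop :=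
  forall i, 0 < u 0 i.

Section FDH.
Context {R : realType} {n m s : nat}.
Variables (X : 'I_n -> 'rV[R]_m) (Y : 'I_n -> 'rV[R]_s).

(* R^(m+s) is the product space R^m * R^s with its product topology; a weight
   vector in {0,1}^n is a boolean vector, embedded in R by %:R. *)
Definition FDH_V : set ('rV[R]_m * 'rV[R]_s) :=
  [set p | exists lam : {ffun 'I_n -> bool},
    [/\ \sum_j (lam j)%:R = 1 :> R,
        vle (\sum_j (lam j)%:R *: X j) p.1,
        vle p.2 (\sum_j (lam j)%:R *: Y j) &
        vle 0 p.2]].

Variable o : 'I_n.

Definition FDH_V_efficient : Prop :=
  ~ exists p, [/\ FDH_V p, vle p.1 (X o), vle (Y o) p.2 & p <> (X o, Y o)].

Definition response_set (alpha : R) : set R :=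
  [set beta | FDH_V (alpha *: X o, beta *: Y o)].

Definition response_dom : set R := [set alpha | response_set alpha !=set0].

(* Only meaningful on [response_dom]. *)
Definition response (alpha : R) : R := set_max (response_set alpha).

Definition alpha_low : R := set_min response_dom.

Definition response_ratio (alpha : R) : R :=
  (response alpha - 1) / (alpha - 1).

Definition sigma_plus : R :=
  set_max [set response_ratio alpha | alpha in [set alpha | 1 < alpha]].

(* The minimum over the empty set is +oo by convention. *)
Definition sigma_minus : \bar R :=
  if alpha_low == 1 then +oo%E
  else (set_min [set response_ratio alpha |
                  alpha in [set alpha | alpha_low <= alpha < 1]])%:E.

Definition zray (delta : R) : 'rV[R]_m * 'rV[R]_s :=
  (delta *: X o, delta *: Y o).

Definition right_IRS : Prop :=
  exists delta : R, 1 < delta /\ FDH_V° (zray delta).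
Definition right_DRS : Prop :=
  forall delta : R, 1 < delta -> (~` FDH_V) (zray delta).
Definition right_CRS : Prop := ~ right_IRS /\ ~ right_DRS.

Definition left_IRS : Prop :=
  forall delta : R, 0 < delta < 1 -> (~` FDH_V) (zray delta).
Definition left_DRS : Prop :=
  exists delta : R, 0 < delta < 1 /\ FDH_V° (zray delta).
Definition left_CRS : Prop := ~ left_IRS /\ ~ left_DRS.

End FDH.

(* Main.v *)
Require Import Defs.
From HB Require Import structures.
From mathcomp Require Import all_boot all_order all_algebra.
From mathcomp Require Import all_classical all_reals all_analysis.
From mathcomp Require Import lra.
Set Implicit Arguments.
Unset Strict Implicit.
Unset Printing Implicit Defensive.
Import Order.TTheory GRing.Theory Num.Theory.
Import numFieldNormedType.Exports.
Local Open Scope classical_set_scope.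
Local Open Scope ring_scope.

(** The statement is about the ray through [DMU_o], and on that ray the
    technology is a finite union of planar corners.  Let [a_j] be the least [t]
    with [x_j <= t x_o] and [b_j] the greatest [t] with [t y_o <= y_j].  Then
    [(alpha x_o, beta y_o)] is feasible iff [a_j <= alpha] and
    [0 <= beta <= b_j] for some [j] (lemma [FDH_V_scaled]), so the response
    function is the step function whose value at [alpha] is the largest [b_j]
    with [a_j <= alpha] (lemma [responseP]).  The returns-to-scale notions
    become conditions on the pairs [(a_j, b_j)]: [z_d] is feasible iff
    [a_j <= d <= b_j] for some [j], and it is interior iff [a_j < d < b_j] for
    some [j] (lemma [interior_zrayP]).  On the other side, comparing a ratio
    [(beta(alpha) - 1) / (alpha - 1)] with [1] amounts to comparing
    [beta(alpha)] with [alpha], in reversed order when [alpha < 1].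

    What links the two is that the extrema defining the sigmas are attained
    (lemmas [sigma_plus_max] and [sigma_minus_min]).  Efficiency forces
    [b_j <= 1] when [a_j <= 1], and [b_j < 1] when [a_j < 1]; moreover
    [b_o >= 1].  Hence [beta(alpha) - 1] is negative to the left of [1] and
    nonnegative to its right.  On a step of the response function the ratio is
    then extremal at the left end of the step, that is at one of the finitely
    many [a_j]; the only exception is the step that starts at [1], on which
    the response is 1 and the ratio 0.

    Once the extrema are attained, [sigma+ > 1] or [sigma- < 1] exhibits an
    [alpha] and a [j] with [a_j <= alpha < b_j]; the midpoint [d] of [alpha]
    and [b_j] satisfies [a_j < d < b_j], hence gives an interior point, and
    [b_j < 1] keeps it on the correct side of [1] in the left case.  Likewise
    [sigma+ < 1] or [sigma- > 1] says that no [alpha] on that side of [1] has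
    [a_j <= alpha <= b_j] for some [j]; when [sigma-] is infinite because all
    [a_j >= 1], this holds trivially on the left.  The constant-returns
    assertions follow from the two others on the same side, since the order is
    total. *)

(** * Attained extrema of real sets *)

Section Extrema.
Context {R : realType}.
Implicit Types A : set R.

Definition is_max A (x : R) : Prop := A x /\ ubound A x.
Definition is_min A (x : R) : Prop := A x /\ lbound A x.

Lemma set_maxP A x : is_max A x -> is_max A (set_max A).
Proof. by move=> hx; apply: (@xgetPex _ 0 (A `&` ubound A)); exists x. Qed.

Lemma set_minP A x : is_min A x -> is_min A (set_min A).
Proof. by move=> hx; apply: (@xgetPex _ 0 (A `&` lbound A)); exists x. Qed.

(** The finitely many values [f i] need not exhaust [A]; they only have to
    dominate it, which is how a maximum over a continuum of [alpha] reduces to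
    one over the units. *)
Lemma set_max_finite (I : finType) (P : pred I) (f : I -> R) A :
  A !=set0 -> (forall i, P i -> A (f i)) ->
  (forall x, A x -> exists2 i, P i & x <= f i) -> is_max A (set_max A).
Proof.
move=> [x0 Ax0] hf hA; have [i0 Pi0 _] := hA _ Ax0.
case: (@arg_maxP _ _ _ i0 P f Pi0) => i Pi fi.
apply: (@set_maxP _ (f i)); split; first exact: hf.
by move=> x /hA[k Pk /le_trans]; apply; exact: fi.
Qed.

Lemma set_min_finite (I : finType) (P : pred I) (f : I -> R) A :
  A !=set0 -> (forall i, P i -> A (f i)) ->
  (forall x, A x -> exists2 i, P i & f i <= x) -> is_min A (set_min A).
Proof.
move=> [x0 Ax0] hf hA; have [i0 Pi0 _] := hA _ Ax0.
case: (@arg_minP _ _ _ i0 P f Pi0) => i Pi fi.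
apply: (@set_minP _ (f i)); split; first exact: hf.
by move=> x /hA[k Pk]; apply: le_trans; exact: fi.
Qed.

Lemma is_max_gt A x c : is_max A x -> (c < x <-> exists2 y, A y & c < y).
Proof.
move=> [Ax ux]; split=> [cx|[y Ay cy]]; first by exists x.
exact: lt_le_trans cy (ux _ Ay).
Qed.

Lemma is_max_lt A x c : is_max A x -> (x < c <-> forall y, A y -> y < c).
Proof.
move=> [Ax ux]; split=> [xc y Ay|]; last exact.
exact: le_lt_trans (ux _ Ay) xc.
Qed.

Lemma is_min_lt A x c : is_min A x -> (x < c <-> exists2 y, A y & y < c).
Proof.
move=> [Ax lx]; split=> [cx|[y Ay cy]]; first by exists x.
exact: le_lt_trans (lx _ Ay) cy.
Qed.

Lemma is_min_gt A x c : is_min A x -> (c < x <-> forall y, A y -> c < y).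
Proof.
move=> [Ax lx]; split=> [xc y Ay|]; last exact.
exact: lt_le_trans xc (lx _ Ay).
Qed.

End Extrema.

(** * Comparing positive vectors along a ray *)

Section Gauge.
Context {R : realType} {k : nat}.
Implicit Types u v : 'rV[R]_k.

(** The least [t] with [u <= t v], for positive nonempty [u] and [v]; the
    default 0 of the maximum is harmless since the ratios are positive. *)
Definition gauge u v : R := \big[Num.max/0]_i (u 0 i / v 0 i).

Lemma gauge_gt0 u v : (0 < k)%N -> vpos u -> vpos v -> 0 < gauge u v.
Proof.
move=> k0 u0 v0; pose i := Ordinal k0.
apply: (@lt_le_trans _ _ (u 0 i / v 0 i)); first exact: divr_gt0.
exact: le_bigmax.
Qed.

Lemma gauge_le u v t : (0 < k)%N -> vpos u -> vpos v ->
  gauge u v <= t <-> vle u (t *: v).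
Proof.
move=> k0 u0 v0; split=> [ut i|ut].
  rewrite mxE -ler_pdivrMr //; apply: le_trans ut.
  exact: (le_bigmax 0 (fun i => u 0 i / v 0 i)).
have uv i : u 0 i / v 0 i <= t by have := ut i; rewrite mxE ler_pdivrMr.
apply: bigmax_le => [|i _]; last exact: uv.
by apply: le_trans (uv (Ordinal k0)); rewrite ltW ?divr_gt0.
Qed.

(** For [t > 0], [t v <= u] is [v <= t^-1 u]: the greatest such [t] is the
    inverse of a gauge with exchanged arguments. *)
Lemma gauge_ge u v t : (0 < k)%N -> vpos u -> vpos v ->
  t <= (gauge v u)^-1 <-> vle (t *: v) u.
Proof.
move=> k0 u0 v0; have g0 := gauge_gt0 k0 v0 u0.
have [t0|t0] := leP t 0.
  split=> _ ; last by rewrite (le_trans t0)// invr_ge0 ltW.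
  by move=> i; rewrite mxE (@le_trans _ _ 0)// ?mulr_le0_ge0// ltW.
rewrite -[X in X <= _]invrK lef_pV2 ?posrE ?invr_gt0// gauge_le//.
by split=> h i; have := h i; rewrite !mxE ler_pdivlMl.
Qed.

End Gauge.

(** * The technology and its interior *)

Section Technology.
Context {R : realType} {n m s : nat}.
Variables (X : 'I_n -> 'rV[R]_m) (Y : 'I_n -> 'rV[R]_s).

(** A boolean weight vector of total weight 1 selects exactly one unit. *)
Lemma FDH_VE p : FDH_V X Y p <->
  exists j, [/\ vle (X j) p.1, vle p.2 (Y j) & vle 0 p.2].
Proof.
split=> [[lam [sum1 hX hY h0]]|[j [hX hY h0]]].
  move: sum1; rewrite -natr_sum => /eqP; rewrite pnatr_eq1.
  case/sum_nat_eq1 => j [_ lj lk].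
  exists j.
  have E (V : lmodType R) (Z : 'I_n -> V) : \sum_j (lam j)%:R *: Z j = Z j.
    rewrite (bigD1 j)//= lj scale1r big1 ?addr0// => k kj.
    by rewrite lk// scale0r.
  by rewrite !E in hX hY.
exists [ffun k => k == j].
have E (V : lmodType R) (Z : 'I_n -> V) :
    \sum_k ([ffun k => k == j] k)%:R *: Z k = Z j.
  rewrite (bigD1 j)//= ffunE eqxx scale1r big1 ?addr0// => k /negPf kj.
  by rewrite ffunE kj scale0r.
rewrite !E; split=> //.
rewrite (bigD1 j)//= ffunE eqxx big1 ?addr0// => k /negPf kj.
by rewrite ffunE kj.
Qed.

Lemma FDH_V_interior (j : 'I_n) (p : 'rV[R]_m * 'rV[R]_s) :
  (forall i, X j 0 i < p.1 0 i) -> (forall i, 0 < p.2 0 i < Y j 0 i) ->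
  (FDH_V X Y)° p.
Proof.
move=> hX hY; rewrite /interior.
have c1 i : continuous (fun q : 'rV[R]_m * 'rV[R]_s => q.1 0 i).
  move=> q; apply: (@continuous_comp _ _ _ fst (fun M : 'rV[R]_m => M 0 i)).
    exact: cvg_fst.
  exact: coord_continuous.
have c2 i : continuous (fun q : 'rV[R]_m * 'rV[R]_s => q.2 0 i).
  move=> q; apply: (@continuous_comp _ _ _ snd (fun M : 'rV[R]_s => M 0 i)).
    exact: cvg_snd.
  exact: coord_continuous.
have nX : nbhs p [set q : 'rV[R]_m * 'rV[R]_s | forall i, X j 0 i < q.1 0 i].
  by apply: (filter_forall (nbhs_filter p)) => i; exact: (cvgr_gt _ (c1 i p)).
have nY : nbhs p [set q : 'rV[R]_m * 'rV[R]_s | forall i, q.2 0 i < Y j 0 i].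
  apply: (filter_forall (nbhs_filter p)) => i; apply: (cvgr_lt _ (c2 i p)).
  by case/andP: (hY i).
have n0 : nbhs p [set q : 'rV[R]_m * 'rV[R]_s | forall i, 0 < q.2 0 i].
  apply: (filter_forall (nbhs_filter p)) => i; apply: (cvgr_gt _ (c2 i p)).
  by case/andP: (hY i).
apply: filterS3 nX nY n0 => q qX qY q0.
by apply/FDH_VE; exists j; split=> i; rewrite ?mxE ltW.
Qed.

(** Moving from an interior point along the curve
    [e |-> ((d - e) x_o, (d + e) y_o)], which makes inputs scarcer and outputs
    larger, stays in the technology for a short while. *)
Lemma interior_perturb (o : 'I_n) d : (FDH_V X Y)° (zray X Y o d) ->
  exists2 e, 0 < e & FDH_V X Y ((d - e) *: X o, (d + e) *: Y o).
Proof.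
move=> hd.
have cX : (d - e) *: X o @[e --> (0 : R)] --> d *: X o.
  apply: cvgZr_tmp.
  have : d - e @[e --> (0 : R)] --> d - 0 by apply: cvgB; [exact: cvg_cst|].
  by rewrite subr0.
have cY : (d + e) *: Y o @[e --> (0 : R)] --> d *: Y o.
  apply: cvgZr_tmp.
  have : d + e @[e --> (0 : R)] --> d + 0 by apply: cvgD; [exact: cvg_cst|].
  by rewrite addr0.
have c : ((d - e) *: X o, (d + e) *: Y o) @[e --> (0 : R)] --> zray X Y o d.
  exact: cvg_pair cX cY.
have nR : \forall e \near 0^'+, FDH_V X Y ((d - e) *: X o, (d + e) *: Y o).
  exact: (cvg_at_right_filter c hd).
near (0 : R)^'+ => e.
by exists e; near: e; [exact: nbhs_right_gt|].
Unshelve. all: by end_near. Qed.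

End Technology.

(** * Reduction to the scales of the units *)

Section Scales.
Context {R : realType} {n m s : nat}.
Variables (X : 'I_n -> 'rV[R]_m) (Y : 'I_n -> 'rV[R]_s) (o : 'I_n).

Definition input_scale j : R := gauge (X j) (X o).
Definition output_scale j : R := (gauge (Y o) (Y j))^-1.

Hypotheses (hm : (0 < m)%N) (hs : (0 < s)%N).
Hypotheses (hX : forall j, vpos (X j)) (hY : forall j, vpos (Y j)).

Local Notation a := input_scale.
Local Notation b := output_scale.

Lemma input_scale_gt0 j : 0 < a j.
Proof. exact: gauge_gt0. Qed.

Lemma output_scale_gt0 j : 0 < b j.
Proof. by rewrite invr_gt0; exact: gauge_gt0. Qed.

Lemma input_scale_self : a o <= 1.
Proof. by apply/gauge_le => // i; rewrite scale1r. Qed.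

Lemma output_scale_self : 1 <= b o.
Proof. by apply/gauge_ge => // i; rewrite scale1r. Qed.

Lemma FDH_V_scaled alpha beta : FDH_V X Y (alpha *: X o, beta *: Y o) <->
  exists j, [/\ a j <= alpha, beta <= b j & 0 <= beta].
Proof.
rewrite FDH_VE /=; split=> -[j [aj bj h0]]; exists j; split.
- exact/gauge_le.
- exact/gauge_ge.
- have := h0 (Ordinal hs); rewrite !mxE pmulr_lge0//; exact: hY.
- exact/gauge_le.
- exact/gauge_ge.
- by move=> i; rewrite !mxE mulr_ge0// ltW//; exact: hY.
Qed.

Lemma FDH_V_scale j alpha : a j <= alpha ->
  FDH_V X Y (alpha *: X o, b j *: Y o).
Proof.
move=> aj; apply/FDH_V_scaled; exists j; split=> //.
by rewrite ltW ?output_scale_gt0.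
Qed.

(** The perturbation of an interior point turns the two weak inequalities into
    strict ones; conversely strict scale inequalities give strict
    componentwise inequalities, an open condition. *)
Lemma interior_zrayP d : 0 < d ->
  (FDH_V X Y)° (zray X Y o d) <-> exists j, a j < d < b j.
Proof.
move=> d0; split=> [/interior_perturb[e e0 /FDH_V_scaled[j [aj bj _]]]|].
  by exists j; apply/andP; split; lra.
move=> [j /andP[aj bj]].
have ajX : vle (X j) (a j *: X o) by exact/gauge_le.
have bjY : vle (b j *: Y o) (Y j) by exact/gauge_ge.
apply: (@FDH_V_interior _ _ _ _ _ _ j) => /= i.
  apply: le_lt_trans (ajX i) _; rewrite !mxE ltr_pM2r//; exact: hX.
apply/andP; split; first by rewrite mxE mulr_gt0//; exact: hY.
apply: lt_le_trans (bjY i); rewrite !mxE ltr_pM2r//; exact: hY.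
Qed.

Lemma zray_inP d : 0 < d ->
  FDH_V X Y (zray X Y o d) <-> exists j, a j <= d <= b j.
Proof.
move=> d0; split=> [/FDH_V_scaled[j [aj bj _]]|[j /andP[aj bj]]].
  by exists j; rewrite aj bj.
by apply/FDH_V_scaled; exists j; split=> //; exact: ltW.
Qed.

Lemma responseP alpha : (exists j, a j <= alpha) ->
  exists j, [/\ a j <= alpha, response X Y o alpha = b j &
                forall k, a k <= alpha -> b k <= response X Y o alpha].
Proof.
move=> [j0 aj0].
have [] : is_max (response_set X Y o alpha) (response X Y o alpha).
  apply: (set_max_finite (P := fun j => a j <= alpha) (f := b)).
  - by exists (b j0); exact: FDH_V_scale.
  - by move=> j aj; exact: FDH_V_scale.
  - by move=> x /FDH_V_scaled[j [aj bj _]]; exists j.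
move=> /FDH_V_scaled[j [aj bj r0]] ub.
have le k : a k <= alpha -> b k <= response X Y o alpha.
  by move=> ak; apply: ub; exact: FDH_V_scale.
by exists j; split=> //; apply/le_anti; rewrite bj le.
Qed.

Lemma gt_responseP alpha : (exists j, a j <= alpha) ->
  alpha < response X Y o alpha <-> exists j, a j <= alpha < b j.
Proof.
move=> /responseP[j [aj -> le]]; split=> [bj|[k /andP[ak]]].
  by exists j; rewrite aj.
by move=> /lt_le_trans; apply; exact: le.
Qed.

Lemma lt_responseP alpha : (exists j, a j <= alpha) ->
  response X Y o alpha < alpha <-> ~ exists j, a j <= alpha <= b j.
Proof.
move=> /responseP[j [aj -> le]]; split=> [bj [k /andP[ak bk]]|nk].
  by have := le_trans bk (le _ ak); rewrite leNgt bj.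
by rewrite ltNge; apply/negP => bj; apply: nk; exists j; rewrite aj.
Qed.

(** The domain of the response function is bounded below by the least [a_j],
    which it contains. *)
Lemma alpha_lowP : (exists j, alpha_low X Y o = a j) /\
  (forall k, alpha_low X Y o <= a k).
Proof.
have dom j : response_dom X Y o (a j).
  by exists (b j); exact: FDH_V_scale.
have [] : is_min (response_dom X Y o) (alpha_low X Y o).
  apply: (set_min_finite (P := predT) (f := a)) => //; first by exists (a o).
  by move=> x [y /FDH_V_scaled[j [aj _ _]]]; exists j.
move=> [y /FDH_V_scaled[j [aj _ _]]] lb; split; last by move=> k; exact: lb.
by exists j; apply/le_anti; rewrite aj andbT; exact: lb.
Qed.

Lemma alpha_low_eq1 : 1 <= alpha_low X Y o -> alpha_low X Y o = 1.
Proof.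
have [_ low] := alpha_lowP => low1.
by apply/le_anti; rewrite low1 (le_trans (low o) input_scale_self).
Qed.

Hypothesis ho : FDH_V_efficient X Y o.

(** * Consequences of efficiency *)

Lemma efficient_scaled alpha beta : FDH_V X Y (alpha *: X o, beta *: Y o) ->
  alpha <= 1 -> 1 <= beta -> alpha = 1 /\ beta = 1.
Proof.
move=> hT a1 b1.
have : (alpha *: X o, beta *: Y o) = (X o, Y o).
  apply: contrapT => ne; apply: ho; exists (alpha *: X o, beta *: Y o).
  split=> //= i; rewrite mxE.
    by rewrite ger_pMl//; exact: hX.
  by rewrite ler_pMl//; exact: hY.
case=> /rowP/(_ (Ordinal hm)) ea /rowP/(_ (Ordinal hs)) eb.
have X0 := hX o (Ordinal hm); have Y0 := hY o (Ordinal hs).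
split; [apply: (mulIf (lt0r_neq0 X0))|apply: (mulIf (lt0r_neq0 Y0))].
  by move: ea; rewrite mxE mul1r.
by move: eb; rewrite mxE mul1r.
Qed.

Lemma output_scale_le1 j : a j <= 1 -> b j <= 1.
Proof.
move=> aj; rewrite leNgt; apply/negP => b1.
have hT := FDH_V_scale (lexx (a j)).
by have [_ bj] := efficient_scaled hT aj (ltW b1); rewrite bj ltxx in b1.
Qed.

Lemma output_scale_lt1 j : a j < 1 -> b j < 1.
Proof.
move=> aj; rewrite ltNge; apply/negP => b1.
have hT := FDH_V_scale (lexx (a j)).
by have [aj1] := efficient_scaled hT (ltW aj) b1; rewrite aj1 ltxx in aj.
Qed.

(** * The extremal ratios are attained *)

(** For [alpha > 1] with response [b_k], the response is already [b_k] or more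
    at [a_k <= alpha].  As [b_k >= 1], replacing [alpha] by [a_k] does not
    decrease the ratio, provided that [a_k > 1].  If [a_k <= 1], efficiency
    gives [b_k = 1] and the ratio at [alpha] is 0. *)
Lemma sigma_plus_max :
  is_max [set response_ratio X Y o alpha | alpha in [set alpha | 1 < alpha]]
    (sigma_plus X Y o).
Proof.
have dom alpha : 1 < alpha -> exists j, a j <= alpha.
  by move=> h; exists o; have := input_scale_self; lra.
(* The value 2 is an arbitrary point of the half-line: the ratio there is
   nonnegative, enough to dominate the ratio 0 of the step through 1. *)
pose c j := if 1 < a j then a j else 2.
have c1 j : 1 < c j by rewrite /c; case: ifP => // _; lra.
apply: (set_max_finite (P := predT) (f := fun j => response_ratio X Y o (c j))).
- by exists (response_ratio X Y o 2); exists 2 => //=; lra.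
- by move=> j _; exists (c j) => //; exact: c1.
- move=> _ [alpha /= al1 <-].
  have [k [ak rk le]] := responseP (dom _ al1); exists k => //.
  have ge1 t : 1 < t -> 1 <= response X Y o t.
    move=> t1; have [j [_ _ h]] := responseP (dom _ t1).
    apply: le_trans output_scale_self (h _ _).
    by have := input_scale_self; lra.
  rewrite /response_ratio /c; case: ifPn => [ak1|]; last first.
    rewrite -leNgt rk => /output_scale_le1 bk.
    have -> : b k = 1 by apply/le_anti; rewrite bk -rk ge1.
    rewrite subrr mul0r divr_ge0 ?subr_ge0 ?ge1//; lra.
  have [j [_ _ /(_ k (lexx _)) lek]] := responseP (dom _ ak1).
  rewrite ler_pM//.
  + by rewrite subr_ge0 ge1.
  + by rewrite invr_ge0 subr_ge0 ltW.
  + by rewrite lerD2r rk.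
  + by rewrite lef_pV2 ?posrE ?subr_gt0// lerD2r.
Qed.

(** For [alpha < 1] the ratio is [(1 - beta(alpha)) / (1 - alpha)] with
    nonnegative numerator.  Moving [alpha] down to the left end [a_k] of its
    step enlarges the denominator and does not enlarge the numerator. *)
Lemma sigma_minus_min : alpha_low X Y o < 1 ->
  exists2 sg, sigma_minus X Y o = sg%:E &
  is_min [set response_ratio X Y o alpha |
            alpha in [set alpha | alpha_low X Y o <= alpha < 1]] sg.
Proof.
move=> low1; rewrite /sigma_minus lt_eqF//.
have [[j0 ej0] low] := alpha_lowP.
eexists; first by [].
apply: (set_min_finite (P := fun j => a j < 1)
  (f := fun j => response_ratio X Y o (a j))).
- exists (response_ratio X Y o (a j0)), (a j0) => //=.
  by rewrite -ej0 lexx.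
- by move=> j aj; exists (a j) => //=; rewrite low.
- move=> _ [alpha /= /andP[al al1] <-].
  have [|k [ak rk _]] := @responseP alpha; first by exists j0; rewrite -ej0.
  have ak1 : a k < 1 := le_lt_trans ak al1.
  exists k => //.
  have [|j [aj rj /(_ k (lexx _)) lek]] := @responseP (a k); first by exists k.
  have rj1 : response X Y o (a k) < 1.
    by rewrite rj output_scale_lt1//; lra.
  rewrite /response_ratio rk -[leRHS]mulrNN -[leLHS]mulrNN -!invrN !opprB.
  rewrite ler_pM//.
  + by rewrite subr_ge0 ltW.
  + by rewrite invr_ge0 subr_ge0 ltW.
  + by rewrite lerD2l lerN2.
  + by rewrite lef_pV2 ?posrE ?subr_gt0// lerD2l lerN2.
Qed.

(** * Ratios against 1, and returns to scale *)

Lemma right_ratio_gt1 alpha : 1 < alpha ->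
  1 < response_ratio X Y o alpha <-> exists j, a j <= alpha < b j.
Proof.
move=> al; rewrite -gt_responseP; last first.
  by exists o; have := input_scale_self; lra.
by rewrite /response_ratio ltr_pdivlMr ?subr_gt0// mul1r ltrD2r.
Qed.

Lemma right_ratio_lt1 alpha : 1 < alpha ->
  response_ratio X Y o alpha < 1 <-> ~ exists j, a j <= alpha <= b j.
Proof.
move=> al; rewrite -lt_responseP; last first.
  by exists o; have := input_scale_self; lra.
by rewrite /response_ratio ltr_pdivrMr ?subr_gt0// mul1r ltrD2r.
Qed.

Lemma left_ratio_lt1 alpha : alpha_low X Y o <= alpha < 1 ->
  response_ratio X Y o alpha < 1 <-> exists j, a j <= alpha < b j.
Proof.
move=> /andP[lo al]; rewrite -gt_responseP; last first.
  by have [[j ej] _] := alpha_lowP; exists j; rewrite -ej.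
by rewrite /response_ratio ltr_ndivrMr ?subr_lt0// mul1r ltrD2r.
Qed.

Lemma left_ratio_gt1 alpha : alpha_low X Y o <= alpha < 1 ->
  1 < response_ratio X Y o alpha <-> ~ exists j, a j <= alpha <= b j.
Proof.
move=> /andP[lo al]; rewrite -lt_responseP; last first.
  by have [[j ej] _] := alpha_lowP; exists j; rewrite -ej.
by rewrite /response_ratio ltr_ndivlMr ?subr_lt0// mul1r ltrD2r.
Qed.

Lemma right_IRS_iff : right_IRS X Y o <-> 1 < sigma_plus X Y o.
Proof.
rewrite (is_max_gt _ sigma_plus_max); split.
  move=> [d [d1 /interior_zrayP[|j /andP[aj bj]]]]; first by lra.
  exists (response_ratio X Y o d); first by exists d.
  by apply/right_ratio_gt1 => //; exists j; rewrite bj ltW.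
move=> [_ [al /= al1 <-]] /right_ratio_gt1[//|j /andP[aj bj]].
(* Right of [al], so strictly above [a j] even when [al = a j]. *)
exists ((al + b j) / 2); split; first by lra.
by apply/interior_zrayP; [lra|exists j; apply/andP; split; lra].
Qed.

Lemma right_DRS_iff : right_DRS X Y o <-> sigma_plus X Y o < 1.
Proof.
rewrite (is_max_lt _ sigma_plus_max); split.
  move=> h _ [al /= al1 <-]; apply/right_ratio_lt1 => // hj.
  by apply: (h al al1); apply/zray_inP => //; lra.
move=> h d d1 /zray_inP hT.
have /right_ratio_lt1 : response_ratio X Y o d < 1 by apply: h; exists d.
by apply=> //; apply: hT; lra.
Qed.

Lemma left_IRS_iff : left_IRS X Y o <-> (1 < sigma_minus X Y o)%E.
Proof.
have [[j0 ej0] low] := alpha_lowP.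
have [low1|low1] := ltP (alpha_low X Y o) 1; last first.
  have e1 := alpha_low_eq1 low1.
  rewrite /sigma_minus e1 eqxx ltry; split=> // _ d /andP[d0 d1].
  by move=> /zray_inP[//|j /andP[aj _]]; have := low j; lra.
have [sg -> hsg] := sigma_minus_min low1.
rewrite lte_fin (is_min_gt _ hsg); split.
  move=> h _ [al /= /andP[lo al1] <-]; apply/left_ratio_gt1; first exact/andP.
  have al0 : 0 < al by apply: lt_le_trans lo; rewrite ej0 input_scale_gt0.
  by move=> hj; apply: (h al); [exact/andP|exact/zray_inP].
move=> h d /andP[d0 d1] /zray_inP => /(_ d0) hj.
have lo : alpha_low X Y o <= d < 1.
  by case: hj => j /andP[aj _]; rewrite d1 andbT (le_trans (low j)).
have /left_ratio_gt1 : 1 < response_ratio X Y o d by apply: h; exists d.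
exact.
Qed.

Lemma left_DRS_iff : left_DRS X Y o <-> (sigma_minus X Y o < 1)%E.
Proof.
have [[j0 ej0] low] := alpha_lowP.
have [low1|low1] := ltP (alpha_low X Y o) 1; last first.
  have e1 := alpha_low_eq1 low1.
  rewrite /sigma_minus e1 eqxx; split=> // -[d [/andP[d0 d1]]].
  move=> /interior_zrayP[//|j /andP[aj _]]; exfalso; have := low j; lra.
have [sg -> hsg] := sigma_minus_min low1.
rewrite lte_fin (is_min_lt _ hsg); split.
  move=> [d [/andP[d0 d1] /interior_zrayP[//|j /andP[aj bj]]]].
  have lo : alpha_low X Y o <= d < 1.
    by rewrite d1 andbT (le_trans (low j))// ltW.
  exists (response_ratio X Y o d); first by exists d.
  by apply/left_ratio_lt1 => //; exists j; rewrite bj ltW.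
move=> [_ [al /= lo <-]] /(left_ratio_lt1 lo)[j /andP[aj bj]].
(* This keeps the midpoint below on the left of 1. *)
have bj1 : b j < 1 by apply: output_scale_lt1; lra.
have a0 := input_scale_gt0 j.
exists ((al + b j) / 2); split; first by apply/andP; split; lra.
by apply/interior_zrayP; [lra|exists j; apply/andP; split; lra].
Qed.

End Scales.

Lemma neither_iff_eq d (T : orderType d) (x c : T) (P Q : Prop) :
  (P <-> (c < x)%O) -> (Q <-> (x < c)%O) -> (~ P /\ ~ Q <-> x = c).
Proof.
move=> -> ->; split=> [[/negP xc /negP cx]|->]; last by rewrite ltxx.
by apply/le_anti; rewrite !leNgt xc cx.
Qed.

Theorem theorem6 (R : realType) (n m s : nat)
  (X : 'I_n -> 'rV[R]_m) (Y : 'I_n -> 'rV[R]_s) (o : 'I_n)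
  (hm : (0 < m)%N) (hs : (0 < s)%N)
  (hX : forall j, vpos (X j)) (hY : forall j, vpos (Y j))
  (ho : FDH_V_efficient X Y o) :
  (right_IRS X Y o <-> 1 < sigma_plus X Y o) /\
  (right_DRS X Y o <-> sigma_plus X Y o < 1) /\
  (right_CRS X Y o <-> sigma_plus X Y o = 1) /\
  (left_IRS X Y o <-> (1 < sigma_minus X Y o)%E) /\
  (left_DRS X Y o <-> (sigma_minus X Y o < 1)%E) /\
  (left_CRS X Y o <-> sigma_minus X Y o = 1%E).
Proof.
have rI := right_IRS_iff hm hs hX hY ho.
have rD := right_DRS_iff hm hs hX hY ho.
have lI := left_IRS_iff hm hs hX hY ho.
have lD := left_DRS_iff hm hs hX hY ho.
do ![split; first by []].
split; first exact: neither_iff_eq rI rD.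
by do 2 split=> //; exact: neither_iff_eq lI lD.
Qed.
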